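(* Let $D_1,D_2$ be Prüfer domains with countable spectrum. Suppose that there is a homeomorphism $\phi:\mathrm{Spec}(D_1)\to\mathrm{Spec}(D_2)$ (with respect to the Zariski topologies) such that a prime ideal $P$ of $D_1$ is idempotent if and only if $\phi(P)$ is idempotent. Then there is an isomorphism of ordered sets $\Phi:\mathrm{SStar}_{\mathrm{st}}(D_1)\to\mathrm{SStar}_{\mathrm{st}}(D_2)$.
   Context: Let $D$ be an integral domain with quotient field $K$ and let $\mathbf{F}(D)$ be the set of $D$-submodules of $K$. A semistar operation on $D$ is a map $\star:\mathbf{F}(D)\to\mathbf{F}(D)$, $I\mapsto I^\star$, such that for all $I,J\in\mathbf{F}(D)$ and $x\in K$: $I\subseteq I^\star$; if $I\subseteq J$ then $I^\star\subseteq J^\star$; $(I^\star)^\star=I^\star$; $(xI)^\star=x\cdot I^\star$. Semistar operations are ordered by $\star_1\leq\star_2$ iff $I^{\star_1}\subseteq I^{\star_2}$ for all $I\in\mathbf{F}(D)$. A semistar operation $\star$ is stable if $(I\cap J)^\star=I^\star\cap J^\star$ for all $I,J\in\mathbf{F}(D)$; $\mathrm{SStar}_{\mathrm{st}}(D)$ is the ordered set of stable semistar operations on $D$. A prime $P$ is idempotent if $P=P^2$. *)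

(* Defs.v *)
From HB Require Import structures.
From mathcomp Require Import all_boot all_order all_algebra.
From mathcomp Require Import all_classical topology.
Set Implicit Arguments.
Unset Strict Implicit.
Unset Printing Implicit Defensive.
Import Order.TTheory GRing.Theory.
Local Open Scope classical_set_scope.
Local Open Scope ring_scope.

Notation tofrac := (@FracField.tofrac _).
Notation "x %:F" := (tofrac x) : ring_scope.

Definition mul_set (R : comNzRingType) (A B : set R) : set R :=
  [set x | exists n (a b : 'I_n -> R),
    [/\ forall i, A (a i), forall i, B (b i) & x = \sum_(i < n) a i * b i]].

Section Spectrum.
Variable D : idomainType.

(* [idealr_closed] includes properness (1 \notin P). *)
Record Spec := MkSpec {
  spec_set :> set D;
  spec_ideal : idealr_closed [in spec_set];
  spec_prime : prime_idealr_closed [in spec_set] }.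

HB.instance Definition _ := gen_eqMixin Spec.
HB.instance Definition _ := gen_choiceMixin Spec.

Definition zariski_closed (A : set D) : set Spec := [set P | A `<=` P].
Definition zariski_open (U : set Spec) := exists A, U = ~` zariski_closed A.

Lemma zariski_openT : zariski_open setT.
Proof.
exists setT; apply/seteqP; split => // P _ PT.
by have [_ /negP + _] := spec_ideal P; apply; rewrite inE; exact: PT.
Qed.

Lemma zariski_openI : setI_closed zariski_open.
Proof.
move=> _ _ [A ->] [B ->].
exists [set x | exists a b, [/\ A a, B b & x = a * b]].
apply/seteqP; split => P /=.
- move=> [/existsNP[a /not_implyP[Aa nPa]] /existsNP[b /not_implyP[Bb nPb]]] h.
  have /h Pab : exists a' b', [/\ A a', B b' & a * b = a' * b'] by exists a, b.
  by have := @spec_prime P a b; rewrite !inE => /(_ Pab) /orP[]; rewrite inE.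
- move=> h; have [_ _ hP] := spec_ideal P.
  have idM a x : spec_set P x -> spec_set P (a * x).
    move=> Px; have := hP a x 0; rewrite addr0 !inE; apply => //.
    by have [+ _ _] := spec_ideal P; rewrite inE.
  split=> hA; apply: h => _ [a [b [Aa Bb ->]]]; last by apply: idM; exact: hA.
  by rewrite mulrC; apply: idM; exact: hA.
Qed.

Lemma zariski_open_bigU (I : Type) (f : I -> set Spec) :
  (forall i, zariski_open (f i)) -> zariski_open (\bigcup_i f i).
Proof.
move=> /choice[A fA]; exists (\bigcup_i A i); rewrite predeqE => P; split.
- move=> [i _]; rewrite fA => nAP AP; apply: nAP => x Ax; apply: AP.
  by exists i.
- move=> /existsNP[x /not_implyP[[i _ Ax] nPx]]; exists i => //.
  by rewrite fA => /(_ _ Ax).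
Qed.

HB.instance Definition _ :=
  isOpenTopological.Build Spec zariski_openT zariski_openI zariski_open_bigU.

Definition idempotent_ideal (P : set D) := P = mul_set P P.

End Spectrum.

Definition homeomorphism (S T : topologicalType) (f : S -> T) :=
  continuous f /\ exists g, [/\ cancel f g, cancel g f & continuous g].

Section Semistar.
Variable D : idomainType.
Local Notation K := {fraction D}.

Record submodule := MkSubmodule {
  submodule_set :> set K;
  submodule0 : submodule_set 0;
  submoduleD : forall x y,
    submodule_set x -> submodule_set y -> submodule_set (x + y);
  submoduleZ : forall (a : D) x, submodule_set x -> submodule_set (a%:F * x) }.

Lemma submodule_eq (I J : submodule) : I = J :> set K -> I = J.
Proof.
case: I J => [I I0 ID IZ] [J J0 JD JZ] /= IJ; subst J.
by congr MkSubmodule; exact: Prop_irrelevance.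
Qed.

Program Definition submoduleI (I J : submodule) : submodule :=
  @MkSubmodule (I `&` J) _ _ _.
Next Obligation. by move=> I J; split; exact: submodule0. Qed.
Next Obligation.
by move=> I J x y [Ix Jx] [Iy Jy]; split; exact: submoduleD.
Qed.
Next Obligation. by move=> I J a x [Ix Jx]; split; exact: submoduleZ. Qed.

Program Definition scale_submodule (x : K) (I : submodule) : submodule :=
  @MkSubmodule [set x * y | y in I] _ _ _.
Next Obligation.
by move=> x I; exists 0; rewrite ?mulr0 //; exact: submodule0.
Qed.
Next Obligation.
move=> x I _ _ [y Iy <-] [z Iz <-]; exists (y + z); rewrite ?mulrDr //.
exact: submoduleD.
Qed.
Next Obligation.
move=> x I a _ [y Iy <-]; exists (a%:F * y); rewrite 1?mulrCA //.
exact: submoduleZ.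
Qed.

(* [star_scale] also covers x = 0, which forces star 0 = 0. *)
Record semistar := MkSemistar {
  star :> submodule -> submodule;
  star_ext : forall I : submodule, I `<=` star I;
  star_mono : forall I J : submodule, I `<=` J -> star I `<=` star J;
  star_idem : forall I : submodule, star (star I) = star I;
  star_scale : forall (x : K) (I : submodule),
    star (scale_submodule x I) = scale_submodule x (star I) }.

HB.instance Definition _ := gen_eqMixin semistar.
HB.instance Definition _ := gen_choiceMixin semistar.

Definition semistar_le (s t : semistar) : bool :=
  `[< forall I : submodule, s I `<=` t I >].

Lemma semistar_le_refl : reflexive semistar_le.
Proof. by move=> s; apply/asboolP => I; exact: subset_refl. Qed.

Lemma semistar_le_anti : antisymmetric semistar_le.
Proof.
move=> s t /andP[/asboolP st /asboolP ts].
have {st ts} : star s = star t.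
  by apply/funext => I; apply: submodule_eq; apply/seteqP.
case: s t => [s s1 s2 s3 s4] [t t1 t2 t3 t4] /= st; subst t.
by congr MkSemistar; exact: Prop_irrelevance.
Qed.

Lemma semistar_le_trans : transitive semistar_le.
Proof.
move=> t s u /asboolP st /asboolP tu; apply/asboolP => I.
exact: subset_trans (st I) (tu I).
Qed.

Fact semistar_display : Order.disp_t. Proof. exact: Order.Disp tt tt. Qed.

HB.instance Definition _ := Order.Le_isPOrder.Build semistar_display semistar
  semistar_le_refl semistar_le_anti semistar_le_trans.

Definition stable (s : semistar) : bool :=
  `[< forall I J : submodule, s (submoduleI I J) = submoduleI (s I) (s J) >].

Definition SStar_st := {s : semistar | stable s}.
HB.instance Definition _ := Choice.on SStar_st.
HB.instance Definition _ : isSub _ _ SStar_st := SubChoice.on SStar_st.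
HB.instance Definition _ :=
  [SubChoice_isSubPOrder of SStar_st by <: with semistar_display].

End Semistar.

Section Prufer.
Variable D : idomainType.

Definition ideal_gen n (g : 'I_n -> D) : set D :=
  [set x | exists c : 'I_n -> D, x = \sum_(i < n) c i * g i].

Definition invertible_ideal (I : set D) :=
  exists J : submodule D,
    mul_set [set x%:F | x in I] J = [set x%:F | x in [set: D]].

(* The family g may contain zeros or repetitions; it generates a nonzero ideal
   exactly when some g i is nonzero. *)
Definition prufer_domain :=
  forall n (g : 'I_n -> D), (exists i, g i != 0) ->
    invertible_ideal (ideal_gen g).

End Prufer.

(* Main.v *)
(* A stable semistar operation is determined by its localizing system, the set
   F of ideals I with 1 in I^*, so it suffices to show that the ordered set of
   localizing systems depends only on the ordered set of primes and on which
   primes are idempotent.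
   For a prime T, the ideals not contained in T form a localizing system; if T
   is idempotent, so do the ideals I with T D_T <= I D_T.  In a Pruefer domain
   with countable spectrum every localizing system F is an intersection of
   systems of these two kinds: a Baire category argument gives, for every ideal
   outside F, a larger ideal outside F that is contracted from some D_P, and in
   the valuation ring D_P a localizing system is {I > T} or {I >= T} with T
   idempotent.  So F is determined by the primes X and the idempotent primes Y
   for which it lies in the system of the first, respectively second, kind.
   Conversely, starting from arbitrary sets (X, Y) and intersecting the
   corresponding systems, the pair attached to the intersection can be computed
   from (X, Y) by a closure operator expressed through inclusions of primes. *)
Require Import Defs.
From mathcomp Require Import all_boot all_order all_algebra.
From mathcomp Require Import all_classical topology.
From mathcomp Require Import ring.

Set Implicit Arguments.
Unset Strict Implicit.
Unset Printing Implicit Defensive.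
Import Order.TTheory GRing.Theory.
Local Open Scope classical_set_scope.
Local Open Scope ring_scope.

Identity Coercion fun_of_set : set >-> Funclass.

(** * Ideals and primes *)

Section Ideals.
Variable D : idomainType.
Implicit Types (P Q : Spec D) (a b x y s : D).

Lemma spec0 P : P 0.
Proof. by have [+ _ _] := spec_ideal P; rewrite inE. Qed.

Lemma spec1 P : ~ P 1.
Proof. by have [_ /negP + _] := spec_ideal P; rewrite inE. Qed.

Lemma specM P a x : P x -> P (a * x).
Proof.
move=> Px; have [_ _ /(_ a x 0)] := spec_ideal P; rewrite !inE addr0.
by apply=> //; exact: spec0.
Qed.

Lemma specD P x y : P x -> P y -> P (x + y).
Proof.
move=> Px Py; have [_ _ /(_ 1 x y)] := spec_ideal P; rewrite !inE mul1r.
exact.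
Qed.

Lemma spec_prod P a b : P (a * b) -> P a \/ P b.
Proof.
have := @spec_prime _ P a b; rewrite !inE => h /h /orP[]; rewrite inE.
  by left.
by right.
Qed.

Lemma specNM P a b : ~ P a -> ~ P b -> ~ P (a * b).
Proof. by move=> nPa nPb /spec_prod[]. Qed.

Lemma specNX P a n : ~ P a -> ~ P (a ^+ n).
Proof.
move=> nPa; elim: n => [|n IH]; first by rewrite expr0; exact: spec1.
by rewrite exprS; exact: specNM.
Qed.

Lemma spec_cancel P s x : ~ P s -> P (s * x) -> P x.
Proof. by move=> nPs /spec_prod[]. Qed.

Lemma spec_eq P Q : P `<=` Q -> Q `<=` P -> P = Q.
Proof.
move=> PQ QP; have : P = Q :> set D by apply/seteqP.
case: P Q {PQ QP} => [P P1 P2] [Q Q1 Q2] /= E; subst Q.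
by congr MkSpec; exact: Prop_irrelevance.
Qed.

(** Improper ideals are allowed, since every localizing system contains the unit ideal. *)
Record ideal := MkIdeal {
  ideal_set :> set D;
  ideal0 : ideal_set 0;
  idealD : forall x y, ideal_set x -> ideal_set y -> ideal_set (x + y);
  idealM : forall a x, ideal_set x -> ideal_set (a * x) }.

Implicit Types (I J L : ideal).

Definition spec_of_ideal I (I1 : ~ I 1)
  (Ip : forall a b, I (a * b) -> I a \/ I b) : Spec D.
Proof.
refine (@MkSpec D I _ _).
- split; rewrite ?inE; [exact: ideal0|by apply/negP; rewrite inE|].
  by move=> a x y; rewrite !inE => Ix Iy; apply: idealD => //; exact: idealM.
- by move=> a b; rewrite !inE => /Ip[] h; apply/orP; [left|right]; rewrite inE.
Defined.

Definition prime_ideal P : ideal := MkIdeal (@spec0 P) (@specD P) (@specM P).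

Definition unit_ideal : ideal.
Proof. by exists [set: D]. Defined.

Definition zero_ideal : ideal.
Proof.
exists [set 0]; [by []| |by move=> a x ->; rewrite /= mulr0].
by move=> x y -> ->; rewrite /= addr0.
Defined.

Lemma ideal_has1 I x : I 1 -> I x.
Proof. by move=> /(idealM x); rewrite mulr1. Qed.

Definition idealI I J : ideal.
Proof.
exists (I `&` J); first by split; exact: ideal0.
- by move=> x y [? ?] [? ?]; split; exact: idealD.
- by move=> a x [? ?]; split; exact: idealM.
Defined.

Definition zero_spec : Spec D.
Proof.
apply: (@spec_of_ideal zero_ideal).
- by move=> /eqP; rewrite oner_eq0.
- by move=> a b /eqP; rewrite mulf_eq0 => /orP[]/eqP; [left|right].
Defined.

Definition colon I x : ideal.
Proof.
exists [set d | I (d * x)].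
- by rewrite /= mul0r; exact: ideal0.
- by move=> y z; rewrite /= mulrDl; exact: idealD.
- by move=> a y; rewrite /= -mulrA; exact: idealM.
Defined.

(* The contraction to D of I D_P. *)
Definition saturation P I : ideal.
Proof.
exists [set y | exists2 s, ~ P s & I (s * y)].
- by exists 1; [exact: spec1|rewrite mulr0; exact: ideal0].
- move=> y z [s nPs Iy] [r nPr Iz]; exists (s * r); first exact: specNM.
  have -> : s * r * (y + z) = r * (s * y) + s * (r * z) by ring.
  by apply: idealD; exact: idealM.
- move=> a y [s nPs Iy]; exists s => //.
  by rewrite mulrCA; exact: idealM.
Defined.

(* I is contracted from the localization D_P. *)
Definition is_local P I := forall s y, ~ P s -> I (s * y) -> I y.

Lemma saturation_local P I : is_local P (saturation P I).
Proof.
move=> s y nPs [r nPr]; rewrite mulrA => Iy; exists (r * s) => //.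
exact: specNM.
Qed.

Lemma sub_saturation P I : I `<=` saturation P I.
Proof. by move=> x Ix; exists 1; [exact: spec1|rewrite mul1r]. Qed.

Lemma local_sub P I : is_local P I -> ~ I 1 -> I `<=` P.
Proof.
move=> lI nI1 x Ix; apply: contrapT => nPx; apply: nI1.
by apply: (lI x) => //; rewrite mulr1.
Qed.

Definition ideal_mulP a P : ideal.
Proof.
exists [set a * p | p in P].
- by exists 0; [exact: spec0|rewrite mulr0].
- move=> _ _ [p Pp <-] [q Qq <-]; exists (p + q); first exact: specD.
  by rewrite mulrDr.
- by move=> b _ [p Pp <-]; exists (b * p); [exact: specM|rewrite mulrCA].
Defined.

Definition principal a : ideal.
Proof.
exists [set a * d | d in [set: D]].
- by exists 0; rewrite ?mulr0.
- by move=> _ _ [d _ <-] [e _ <-]; exists (d + e); rewrite ?mulrDr.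
- by move=> b _ [d _ <-]; exists (b * d); rewrite // mulrCA.
Defined.

Lemma exists_prime_over I : ~ I 1 -> exists P, I `<=` P.
Proof.
move=> nI1.
(* Zorn's lemma asks [p] also of the union of the empty chain; adjoining [I] to [A] makes the empty
   set stand for [I] itself. *)
pose p (A : set D) := exists2 K : ideal, K = A `|` I :> set D & ~ K 1.
have [F Fp Ftot|M [[K KE nK1] Mmax]] := @Zorn_bigcup _ p.
  have ch A x y : F A -> (A `|` I) x -> (A `|` I) y -> (A `|` I) (x + y).
    by move=> /Fp[L <- _]; exact: idealD.
  suff [L LE] : exists L : ideal, L = \bigcup_(X in F) X `|` I :> set D.
    exists L => //; rewrite LE => -[[A FA A1]|//].
    by have [L' L'E] := Fp _ FA; apply; rewrite L'E; left.
  unshelve eexists; first (exists (\bigcup_(X in F) X `|` I)); last by [].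
  - by right; exact: ideal0.
  - have upA A : F A -> A `|` I `<=` \bigcup_(X in F) X `|` I.
      by move=> FA x [Ax|Ix]; [left; exists A|right].
    move=> x y [[A FA Ax]|Ix] [[B FB By]|Iy].
    + have [AB|BA] := Ftot _ _ FA FB.
        by apply: (upA B FB); apply: ch => //; left => //; exact: AB.
      by apply: (upA A FA); apply: ch => //; left => //; exact: BA.
    + by apply: (upA A FA); apply: ch => //; [left|right].
    + by apply: (upA B FB); apply: ch => //; [right|left].
    + by right; exact: idealD.
  - move=> a x [[A FA Ax]|Ix]; last by right; exact: idealM.
    have [L LE _] := Fp _ FA.
    have : L x by rewrite LE; left.
    by move=> /(idealM a); rewrite LE => -[?|?]; [left; exists A|right].
have IK : I `<=` K by rewrite KE; right.
have KM : K `<=` M.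
  move=> x Kx; apply: contrapT => nMx.
  apply: (Mmax K); last by exists K => //; rewrite setUidl.
  by split=> [y My|/(_ _ Kx)//]; rewrite KE; left.
have Kmax (L : ideal) : K `<=` L -> ~ L 1 -> L `<=` K.
  move=> KL nL1 x Lx; apply: contrapT => nKx.
  apply: (Mmax L); last first.
    by exists L => //; rewrite setUidl //; exact: subset_trans KL.
  split=> [|LM]; last by apply: nKx; rewrite KE; left; exact: LM.
  by move=> y My; apply: KL; rewrite KE; left.
suff Kp a b : K (a * b) -> K a \/ K b by exists (spec_of_ideal nK1 Kp).
(* If b is outside K, then (K : b) is a proper ideal above K, so by maximality it lies in K; and it
   contains a. *)
move=> Kab; have [Ka|nKa] := pselect (K a); [by left|right].
have Kb : K `<=` colon K b by move=> x Kx; rewrite /= mulrC; exact: idealM.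
apply: contrapT => nKb; apply: nKa.
by apply: (Kmax (colon K b)) => //=; rewrite mul1r.
Qed.

(* A Baire category argument: otherwise one builds f_0, f_1, ... outside J,
   each dividing the next, such that (J : f_(n+1)) is not contained in the
   n-th prime; the proper ideal union of the (J : f_n) lies in no prime. *)
Lemma countable_local_colon J : countable [set: Spec D] -> ~ J 1 ->
  exists x P, ~ J x /\ is_local P (colon J x).
Proof.
move=> cnt nJ1; apply: contrapT => nloc.
have step P f : ~ J f ->
    exists g, ~ J (f * g) /\ exists2 h, ~ P h & J (h * (f * g)).
  move=> nJf; apply: contrapT => nstep; apply: nloc; exists f, P; split => //.
  move=> s y nPs; rewrite /= -mulrA => Jsyf; apply: contrapT => nJyf.
  apply: nstep; exists y; rewrite (mulrC f); split => //.
  by exists s.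
have [e eP] : exists e : nat -> Spec D, forall P, exists n, e n = P.
  have /pfcard_geP[/seteqP[/(_ zero_spec)/(_ Logic.I)]//|[e]] := cnt.
  exists e => P; have [n _ <-] := 'surj_e (Logic.I : [set: Spec D] P).
  by exists n.
have {}step : forall P f, {g | ~ J f ->
    ~ J (f * g) /\ exists2 h, ~ P h & J (h * (f * g))}.
  move=> P f; apply: cid.
  have [Jf|/(step P)[g ?]] := pselect (J f); first by exists 1.
  by exists g.
pose f := fix f n : D := if n is m.+1 then f m * sval (step (e m) (f m)) else 1.
have fS n : f n.+1 = f n * sval (step (e n) (f n)) by [].
have nJf n : ~ J (f n).
  elim: n => // n IH; rewrite fS.
  by have [] := svalP (step (e n) (f n)) IH.
have fdvd n m : exists c, f (n + m)%N = f n * c.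
  elim: m => [|m [c cE]]; first by exists 1; rewrite addn0 mulr1.
  by rewrite addnS fS cE -mulrA; eexists.
pose U := [set y | exists n, J (y * f n)].
have U0 : U 0 by exists 0%N; rewrite mul0r; exact: ideal0.
have UD x y : U x -> U y -> U (x + y).
  move=> [n Jx] [m Jy]; exists (n + m)%N; rewrite mulrDl.
  have [c E] := fdvd n m; have [d E'] := fdvd m n.
  apply: idealD; first by rewrite E mulrA mulrC; exact: idealM.
  by rewrite addnC E' mulrA mulrC; exact: idealM.
have UM a x : U x -> U (a * x).
  by move=> [n Jx]; exists n; rewrite -mulrA; exact: idealM.
have [|Q UQ] := @exists_prime_over (MkIdeal U0 UD UM).
  by move=> [n]; rewrite mul1r; exact: nJf.
have [n en] := eP Q.
have [h nPh Jh] : exists2 h, ~ e n h & J (h * f n.+1).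
  by rewrite fS; have [] := svalP (step (e n) (f n)) (nJf n).
by apply: nPh; rewrite en; apply: UQ; exists n.+1.
Qed.

End Ideals.

(** * Localizing systems *)

Section LocalizingSystems.
Variable D : idomainType.
Implicit Types (P Q T U S : Spec D) (a b x y s : D) (I J K L : ideal D).
Implicit Types (X Y : set (Spec D)) (F : set (ideal D)).

(* The zero ideal is excluded because star_scale at 0 forces star 0 = 0. *)
Definition localizing F :=
  [/\ F (unit_ideal D), ~ F (zero_ideal D),
      forall I J, I `<=` J -> F I -> F J &
      forall I J, F I -> (forall x, I x -> F (colon J x)) -> F J].

Definition not_within T I := exists2 s, I s & ~ T s.

(* T D_T is contained in I D_T. *)
Definition locally_contains T I :=
  forall t, T t -> exists2 s, ~ T s & I (s * t).

Definition cut_system X Y : set (ideal D) :=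
  [set I | (forall T, X T -> not_within T I) /\
           (forall T, Y T -> locally_contains T I)].

(** For a localizing F, this set and [idem_bounded F] are the largest X and the largest set Y of
    idempotent primes such that F lies in [cut_system X Y]. *)
Definition excluded F : set (Spec D) := [set T | ~ F (prime_ideal T)].

Definition idem_bounded F : set (Spec D) :=
  [set T : Spec D | idempotent_ideal T /\ F `<=` locally_contains T].

(** For x in I the ideal (K : x) contains J. Any K that contains the products will do, so the ideal
    IJ is never formed. *)
Lemma localizing_mul F I J K : localizing F -> F I -> F J ->
  (forall x y, I x -> J y -> K (x * y)) -> F K.
Proof.
move=> [_ _ up comp] FI FJ IJK; apply: (comp I) => // x Ix.
by apply: (up J) => // y Jy; rewrite /= mulrC; exact: IJK.
Qed.

Lemma localizingI F I J : localizing F -> F I -> F J -> F (idealI I J).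
Proof.
move=> locF FI FJ; apply: (localizing_mul locF FI FJ) => x y Ix Jy; split.
  by rewrite mulrC; exact: idealM.
exact: idealM.
Qed.

(** The intersection with D of the closure of I under the stable operation attached to F. *)
Definition closure_ideal F (locF : localizing F) I : ideal D.
Proof.
exists [set y | F (colon I y)]; have [F1 _ up _] := locF.
- by apply: up F1 => x _; rewrite /= mulr0; exact: ideal0.
- move=> x y /= Fx Fy; apply: (up _ _ _ (localizingI locF Fx Fy)) => d [dx dy].
  by rewrite /= mulrDr; exact: idealD.
- by move=> a y; apply: up => d; rewrite /= mulrCA; exact: idealM.
Defined.

Lemma excludedP F T : localizing F ->
  excluded F T <-> F `<=` not_within T.
Proof.
move=> [_ _ up _]; split=> [nFT I FI|FT FT'].
  apply: contrapT => nTI; apply: nFT; apply: up FI => x Ix.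
  by apply: contrapT => nTx; apply: nTI; exists x.
by have [s] := FT _ FT'.
Qed.

(** D_P is a valuation ring. Invertibility of (a, b) gives u, v in the inverse with au + bv = 1; one
    of au, bv is outside P, and it serves as s. *)
Lemma prufer_div (pr : prufer_domain D) P a b :
  exists2 s, ~ P s & (exists c, s * a = b * c) \/ (exists c, s * b = a * c).
Proof.
have [->|a0] := eqVneq a 0.
  exists 1; first exact: spec1.
  by left; exists 0; rewrite !mulr0.
pose g (i : 'I_2) := if i == ord0 then a else b.
have [|J /seteqP[JD DJ]] := pr 2 g; first by exists ord0; rewrite /g eqxx.
have [|n [x [y [xI yJ E]]]] := DJ 1; first by exists 1; rewrite ?tofrac1.
have /choice[c cE] : forall i, exists c : 'I_2 -> D,
    x i = (c ord0 * a + c (lift ord0 ord0) * b)%:F.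
  move=> i; have [_ [c ->] <-] := xI i; exists c.
  by rewrite big_ord_recl big_ord1 /g /=.
(* Collecting the coefficients of each generator in the expansion of 1 gives a * [u k0] + b * [u k1]
   = 1. *)
pose u k := \sum_i (c i k)%:F * y i.
have uJ k : J (u k).
  rewrite /u; elim/big_ind: _ => [|v w|i _].
  - exact: submodule0.
  - exact: submoduleD.
  - by apply: submoduleZ; exact: yJ.
have int e k : ideal_gen g e -> exists d, e%:F * u k = d%:F.
  move=> ge; have [|d _ <-] := JD (e%:F * u k); last by exists d.
  exists 1%N, (fun=> e%:F), (fun=> u k); split; rewrite ?big_ord1 //.
  by move=> _; exists e.
have ga : ideal_gen g a.
  exists (fun i => if i == ord0 then 1 else 0).
  by rewrite big_ord_recl big_ord1 /g /= mul1r mul0r addr0.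
have gb : ideal_gen g b.
  exists (fun i => if i == ord0 then 0 else 1).
  by rewrite big_ord_recl big_ord1 /g /= mul1r mul0r add0r.
set k0 : 'I_2 := ord0 in cE *; set k1 : 'I_2 := lift ord0 ord0 in cE *.
have [al alE] := int _ k0 ga; have [be beE] := int _ k1 gb.
have [ga' gaE] := int _ k1 ga; have [de deE] := int _ k0 gb.
have sum1 : al + be = 1.
  apply/eqP; rewrite -tofrac_eq tofracD tofrac1 -alE -beE E /u !big_distrr /=.
  rewrite -big_split /=; apply/eqP/eq_bigr => i _.
  by rewrite cE tofracD !tofracM; ring.
have [Pal|nPal] := pselect (P al); last first.
  exists al => //; right; exists de; apply/eqP.
  by rewrite -tofrac_eq !tofracM -alE -deE; apply/eqP; ring.
have nPbe : ~ P be.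
  by move=> Pbe; apply: (@spec1 _ P); rewrite -sum1; exact: specD.
exists be => //; left; exists ga'; apply/eqP.
by rewrite -tofrac_eq !tofracM -beE -gaE; apply/eqP; ring.
Qed.

Lemma mul_set_sub T : mul_set T T `<=` T.
Proof.
move=> _ [n [a [b [aT bT ->]]]].
elim/big_ind: _ => [|v w|i _]; [exact: spec0|exact: specD|].
by apply: specM; exact: bT.
Qed.

Definition square_ideal T : ideal D.
Proof.
exists (mul_set T T).
- by exists 0%N, (fun=> 0), (fun=> 0); split; [case|case|rewrite big_ord0].
- move=> _ _ [n [a [b [aT bT ->]]]] [m [c [d [cT dT ->]]]].
  exists (n + m)%N,
    (fun i => match fintype.split i with inl j => a j | inr k => c k end),
    (fun i => match fintype.split i with inl j => b j | inr k => d k end); split.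
  + by move=> i; case: (fintype.split i).
  + by move=> i; case: (fintype.split i).
  + rewrite big_split_ord /=; congr (_ + _); apply: eq_bigr => i _.
      by rewrite (unsplitK (inl i)).
    by rewrite (unsplitK (inr i)).
- move=> e _ [n [a [b [aT bT ->]]]]; exists n, (fun i => e * a i), b.
  split=> // [i|]; first exact: specM.
  by rewrite big_distrr /=; apply: eq_bigr => i _; rewrite mulrA.
Defined.

(** * Idempotent primes and cut systems in a Prüfer domain *)

Section Prufer.
Hypothesis pr : prufer_domain D.

Definition locally_square T :=
  forall t, T t -> exists s a b, [/\ ~ T s, T a, T b & s * t = a * b].

(** Induction on the number of terms: in D_T one of the left factors u, x divides the other, so two
    products merge into one. *)
Lemma mul_set_factor T t : mul_set T T t ->
  exists s a b, [/\ ~ T s, T a, T b & s * t = a * b].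
Proof.
move=> [n [a [b [aT bT ->]]]].
elim: n a b aT bT => [|n IH] a b aT bT.
  exists 1, 0, 0; rewrite big_ord0 !mulr0; split=> //; try exact: spec0.
  exact: spec1.
rewrite big_ord_recr /=.
have [//|//|s [u [v [nTs Tu Tv E]]]] := IH (fun i => a (widen_ord (leqnSn n) i))
  (fun i => b (widen_ord (leqnSn n) i)).
rewrite /= in E; set S := \sum_(i < n) _ in E *.
have Ta := aT ord_max; have Tb := bT ord_max.
set x := a _ in Ta *; set y := b _ in Tb *; clearbody S x y.
have [r nTr [[c Ec]|[c Ec]]] := prufer_div pr T u x.
- exists (r * s), x, (c * v + r * s * y); split=> //; first exact: specNM.
    by apply: specD; exact: specM.
  by ring: E Ec.
- exists (r * s), u, (r * v + s * c * y); split=> //; first exact: specNM.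
    by apply: specD; exact: specM.
  by ring: E Ec.
Qed.

(** In D_P the factor a divides t: otherwise cancelling t in s t = a b would put an element outside
    T into T. The quotient c is in T because s c = r b. *)
Lemma locally_square_at T P t : locally_square T -> T `<=` P -> T t ->
  exists s a b, [/\ ~ P s, T a, T b & s * t = a * b].
Proof.
move=> sqT TP Tt; have [t0|t0] := eqVneq t 0.
  exists 1, 0, 0; rewrite t0 !mulr0; split=> //; try exact: spec0.
  exact: spec1.
have [s [a [b [nTs Ta Tb E]]]] := sqT _ Tt.
have [r nPr [[c Ec]|[c Ec]]] := prufer_div pr P a t; last first.
  exists r, a, c; split=> //.
  have a0 : a != 0.
    apply: contra_notN nTs => /eqP a0; move/eqP: E; rewrite a0 mul0r mulf_eq0.
    by rewrite (negPf t0) orbF => /eqP ->; exact: spec0.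
  apply: (spec_cancel nTs); suff -> : s * c = r * b by exact: specM.
  by apply: (mulfI a0); transitivity (r * (s * t)); [ring: Ec|ring: E].
have nTr : ~ T r by move=> /TP.
exfalso; apply: (specNM nTr nTs); suff -> : r * s = c * b by exact: specM.
by apply: (mulfI t0); ring: E Ec.
Qed.

(** For t in T, the ideal (T^2 : t) lies in no prime P: if P contains T, t factors locally at P; if
    not, any element of T outside P multiplies t into T^2. *)
Lemma locally_squareP T : idempotent_ideal T <-> locally_square T.
Proof.
split=> [idT t|sqT]; first by rewrite {1}idT; exact: mul_set_factor.
apply/seteqP; split; last exact: mul_set_sub.
move=> t Tt; apply: contrapT => nTt.
have [|P cP] := @exists_prime_over _ (colon (square_ideal T) t).
  by rewrite /= mul1r.
have TT a b : T a -> T b -> mul_set T T (a * b).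
  by exists 1%N, (fun=> a), (fun=> b); rewrite big_ord1.
have [TP|/existsNP[a /not_implyP[Ta nPa]]] := pselect (T `<=` P).
  have [s [a [b [nPs Ta Tb E]]]] := locally_square_at sqT TP Tt.
  by apply/nPs/cP; rewrite /= E; exact: TT.
by apply/nPa/cP; exact: TT.
Qed.

(** The zero prime in X keeps the zero ideal out. Idempotence gives the composition axiom for Y: t
    is locally a product ab, where a is absorbed by I and then b by a colon of J. *)
Lemma cut_system_localizing X Y :
  X (zero_spec D) -> Y `<=` @idempotent_ideal D ->
  localizing (cut_system X Y).
Proof.
move=> X0 Yid; split.
- split=> T _; first by exists 1 => //; exact: spec1.
  by move=> t _; exists 1 => //; exact: spec1.
- by move=> [/(_ _ X0)[s]].
- move=> I J IJ [IX IY]; split=> T.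
    by move=> /IX[s Is nTs]; exists s => //; exact: IJ.
  by move=> /IY h t /h[s nTs Ist]; exists s => //; exact: IJ.
- move=> I J [IX IY] h; split=> T.
    move=> XT; have [s Is nTs] := IX _ XT.
    have [/(_ _ XT)[r Jrs nTr] _] := h _ Is.
    by exists (r * s) => //; exact: specNM.
  move=> YT t Tt.
  have [s [a [b [nTs Ta Tb E]]]] :=
    iffLR (locally_squareP _) (Yid _ YT) _ Tt.
  have [r nTr Ira] := IY _ YT _ Ta.
  have [_ /(_ _ YT _ Tb)[q nTq Jq]] := h _ Ira.
  exists (q * r * s); first by do 2?apply: specNM.
  suff -> : q * r * s * t = q * b * (r * a) by [].
  by ring: E.
Qed.

Lemma spec_chain P S T : S `<=` P -> T `<=` P -> S `<=` T \/ T `<=` S.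
Proof.
move=> SP TP; apply: contrapT => /not_orP[/existsNP[a /not_implyP[Sa nTa]]].
move=> /existsNP[b /not_implyP[Tb nSb]].
have [r nPr [[c E]|[c E]]] := prufer_div pr P a b.
  have nTr : ~ T r by move=> /TP.
  by apply: nTa; apply: (spec_cancel nTr); rewrite E mulrC; exact: specM.
have nSr : ~ S r by move=> /SP.
by apply: nSb; apply: (spec_cancel nSr); rewrite E mulrC; exact: specM.
Qed.

(** The conditions are tested on T itself: it is within Q when T <= Q, and it fails to contain Q
    locally exactly when it is strictly inside Q. *)
Lemma excluded_cut_system X Y T :
  excluded (cut_system X Y) T <->
  exists2 Q : Spec D, T `<=` Q & X Q \/ (Y Q /\ T <> Q).
Proof.
split=> [nT|[Q TQ [XQ|[YQ TneQ]]]].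
- apply: contrapT => nQ; apply: nT; split=> Q => [XQ|YQ t Qt].
    apply: contrapT => nTQ; apply: nQ; exists Q; last by left.
    by move=> x Tx; apply: contrapT => nQx; apply: nTQ; exists x.
  have [TQ|/existsNP[s /not_implyP[Ts nQs]]] := pselect (T `<=` Q).
    have [TeqQ|TneQ] := pselect (T = Q).
      by exists 1; [exact: spec1|rewrite TeqQ mul1r].
    by case: nQ; exists Q => //; right.
  by exists s => //; rewrite mulrC; exact: specM.
- by move=> [/(_ _ XQ)[s /TQ]].
- move=> [_ /(_ _ YQ) h]; apply: TneQ; apply: spec_eq => // t Qt.
  by have [s nQs /(spec_cancel _)] := h _ Qt; apply => /TQ.
Qed.

(** The condition on U says that T is the least upper bound, among the primes inside T, of those
    lying under a member of X or Y. *)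
Lemma idem_bounded_cut_system X Y T : Y `<=` @idempotent_ideal D ->
  idem_bounded (cut_system X Y) T <->
  idempotent_ideal T /\ forall U : Spec D, U `<=` T -> U <> T ->
    exists S : Spec D, [/\ S `<=` T, ~ S `<=` U &
      exists2 Q : Spec D, S `<=` Q & X Q \/ Y Q].
Proof.
move=> Yid; split=> -[idT h]; split=> //.
- move=> U UT UneT; apply: contrapT => nS.
  have [x Tx nUx] : exists2 x, T x & ~ U x.
    apply: contrapT => nx; apply: UneT; apply: spec_eq => // x Tx.
    by apply: contrapT => nUx; apply: nx; exists x.
  have x0 : x != 0 by apply: contra_notN nUx => /eqP->; exact: spec0.
  pose I := saturation T (principal x).
  have IP y d s : ~ T s -> s * y = x * d -> I y.
    by move=> nTs E; exists s => //; exists d.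
  (* The radical of I is a prime below T containing x. *)
  pose S := [set y | exists n, I (y ^+ n)].
  have S0 : S 0 by exists 1%N; rewrite expr1; exact: ideal0.
  have SM a y : S y -> S (a * y).
    by move=> [n Iy]; exists n; rewrite exprMn; exact: idealM.
  have lI : is_local T I by exact: saturation_local.
  have lS s y : ~ T s -> S (s * y) -> S y.
    move=> nTs [n]; rewrite exprMn => Isy; exists n.
    by apply: lI Isy; exact: specNX.
  have SD y z : S y -> S z -> S (y + z).
    move=> Sy Sz; have [r nTr [[c E]|[c E]]] := prufer_div pr T y z.
      apply: (lS r) => //; suff -> : r * (y + z) = (r + c) * z by exact: SM.
      by ring: E.
    apply: (lS r) => //; suff -> : r * (y + z) = (r + c) * y by exact: SM.
    by ring: E.
  have S1 : ~ S 1.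
    move=> [n]; rewrite expr1n => -[s nTs]; rewrite mulr1 => -[d _ E].
    by apply: nTs; rewrite -E mulrC; exact: specM.
  have Ssq y : S (y * y) -> S y.
    by move=> [n Iy]; exists (n + n)%N; rewrite exprD -exprMn.
  have Sp y z : S (y * z) -> S y \/ S z.
    move=> Syz; have [r nTr [[c E]|[c E]]] := prufer_div pr T y z; [left|right].
      apply/Ssq/(lS r) => //; suff -> : r * (y * y) = c * (y * z) by exact: SM.
      by ring: E.
    apply/Ssq/(lS r) => //; suff -> : r * (z * z) = c * (y * z) by exact: SM.
    by ring: E.
  pose SS := @spec_of_ideal _ (MkIdeal S0 SD SM) S1 Sp.
  have IT : I `<=` T.
    move=> y [s nTs [d _ E]]; apply: (spec_cancel nTs).
    by rewrite -E mulrC; exact: specM.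
  have ST : SS `<=` T.
    by move=> y [n /IT]; apply: contraPP; exact: specNX.
  have Sx : SS x.
    exists 1%N; rewrite expr1.
    by apply: (IP _ 1 1); [exact: spec1|rewrite mulrC].
  have XYI Q : X Q \/ Y Q -> not_within Q I.
    move=> XYQ; apply: contrapT => IQ; apply: nS; exists SS; split=> //.
      by move=> /(_ _ Sx).
    exists Q => // y [n Iy]; apply: contrapT => nQy; apply: IQ.
    by exists (y ^+ n) => //; exact: specNX.
  have cutI : cut_system X Y I.
    split=> Q; first by move=> XQ; apply: XYI; left.
    move=> YQ q Qq; have [|s Is nQs] := XYI Q; first by right.
    by exists s => //; rewrite mulrC; exact: idealM.
  have IT' y : T y -> exists2 s, ~ T s & exists d, s * y = x * d.
    move=> Ty; have [s nTs [r nTr [d _ E]]] := h _ cutI _ Ty.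
    by exists (r * s); [exact: specNM|exists d; rewrite E mulrA].
  (* Now T D_T = x D_T. Idempotence writes x locally as ab with a and b both multiples of x;
     cancelling one x puts an element outside T into T. *)
  have [s [a [b [nTs Ta Tb E]]]] := iffLR (locally_squareP _) idT _ Tx.
  have [r nTr [d Ed]] := IT' _ Ta; have [q nTq [e Ee]] := IT' _ Tb.
  apply: (specNM (specNM nTs nTr) nTq).
  suff -> : s * r * q = d * e * x by exact: specM.
  apply: (mulfI x0); transitivity (r * q * (s * x)); first by ring.
  transitivity ((r * a) * (q * b)); first by rewrite E; ring.
  by rewrite Ed Ee; ring.
- move=> I [IX IY] t Tt; apply: contrapT => nI.
  have {}nI s : ~ T s -> ~ I (s * t) by move=> nTs Ist; apply: nI; exists s.
  have t0 : t != 0.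
    apply/eqP => t0; apply: (nI 1); first exact: spec1.
    by rewrite t0 mulr0; exact: ideal0.
  (* The largest prime below T that does not contain t. *)
  pose U := [set x | exists R : Spec D, [/\ R `<=` T, ~ R t & R x]].
  have Uchain x y : U x -> U y ->
      exists R : Spec D, [/\ R `<=` T, ~ R t, R x & R y].
    move=> [R [RT nRt Rx]] [Q [QT nQt Qy]].
    have [RQ|QR] := spec_chain RT QT; first by exists Q; split=> //; exact: RQ.
    by exists R; split=> //; exact: QR.
  have U0 : U 0.
    exists (zero_spec D); split=> //; last by move/eqP; rewrite (negPf t0).
    by move=> _ ->; exact: spec0.
  have UD x y : U x -> U y -> U (x + y).
    move=> Ux Uy; have [R [? ? ? ?]] := Uchain _ _ Ux Uy.
    by exists R; split=> //; exact: specD.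
  have UM a x : U x -> U (a * x).
    by move=> [R [? ? ?]]; exists R; split=> //; exact: specM.
  have U1 : ~ U 1 by move=> [R [_ _ /spec1]].
  have Up x y : U (x * y) -> U x \/ U y.
    by move=> [R [? ? /spec_prod[]]]; [left|right]; exists R.
  pose V := @spec_of_ideal _ (MkIdeal U0 UD UM) U1 Up.
  have nVt : ~ V t by move=> [R []].
  have [||S [ST nSU [Q SQ XYQ]]] := h V; first by move=> x [R [+ _]]; apply.
    by move=> VT; apply: nVt; rewrite VT.
  have St : S t.
    by apply: contrapT => nSt; apply: nSU => x Sx; exists S.
  (* I lies in S: since t is not in I D_T, every element of I is locally a multiple of t, which is
     in S. *)
  have out s : I s -> ~ S s -> False.
    move=> Is nSs; have [r nTr [[c E]|[c E]]] := prufer_div pr T s t.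
      have nSr : ~ S r by move=> /ST.
      by apply: (specNM nSr nSs); rewrite E mulrC; exact: specM.
    by apply: (nI r) => //; rewrite E mulrC; exact: idealM.
  case: XYQ => [XQ|YQ].
    by have [s Is nQs] := IX _ XQ; apply: (out s) => // /SQ.
  have [QS|/existsNP[q /not_implyP[Qq nSq]]] := pselect (Q `<=` S); last first.
    have [s nQs Isq] := IY _ YQ _ Qq; apply: (out _ Isq).
    by apply: specNM => // /SQ.
  (* So S is idempotent and locally t = a c with a, c in S. As s is outside S, it divides c in D_T,
     and s a in I puts t into I D_T. *)
  have {QS SQ} QS := spec_eq QS SQ; rewrite {Q}QS in YQ.
  have [r [a [c [nTr Sa Sc E]]]] :=
    locally_square_at (iffLR (locally_squareP _) (Yid _ YQ)) ST St.
  have [s nSs Isa] := IY _ YQ _ Sa.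
  have [q nTq [[d Ed]|[d Ed]]] := prufer_div pr T c s.
    apply: (nI (q * r)); first exact: specNM.
    suff -> : q * r * t = d * (s * a) by exact: idealM.
    by transitivity (q * (a * c)); [rewrite -E; ring|ring: Ed].
  have nSq : ~ S q by move=> /ST.
  by apply: (specNM nSq nSs); rewrite Ed mulrC; exact: specM.
Qed.

(** For the converse, an ideal I outside F is enlarged to its closure J and then to L = (J : x),
    local at some P and still outside F; the conditions on I at P or at the cut of D_P are then
    contradicted. *)
Lemma localizing_cut_system F : countable [set: Spec D] -> localizing F ->
  forall I, F I <-> cut_system (excluded F) (idem_bounded F) I.
Proof.
move=> cnt locF I; have [F1 F0 up comp] := locF; split=> [FI|[IX IY]].
  split=> T; last by move=> [_]; apply.
  by move=> /(excludedP _ locF); apply.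
apply: contrapT => nFI.
pose J := closure_ideal locF I.
have IJ : I `<=` J by move=> x Ix; apply: up F1 => d _ /=; exact: idealM.
have nJ1 : ~ J 1 by move=> /= h; apply: nFI; apply: up h => x /=; rewrite mulr1.
have Jcl x : F (colon J x) -> J x.
  move=> FJx; apply: (comp _ _ FJx) => y /=.
  by apply: up => d /=; rewrite mulrA.
have [x [P [nJx lL]]] := countable_local_colon cnt nJ1.
pose L := colon J x; rewrite -/L in lL.
have nFL : ~ F L by move=> /Jcl.
have IL : I `<=` L.
  by move=> y /IJ Jy; suff : J (y * x) by []; rewrite mulrC; exact: idealM.
have LP : L `<=` P.
  apply: local_sub => // L1; apply: nFL.
  by apply: up F1 => d _; exact: ideal_has1.
have [FP|nFP] := pselect (F (prime_ideal P)); last first.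
  by have [s /IL/LP] := IX _ nFP.
(* The cut of the system induced by F on the valuation ring D_P. *)
pose T := [set y | forall K, F K -> is_local P K -> K y].
pose M a := saturation P (principal a).
(* Ideals of D_P are comparable, so a local K missing a lies inside a D_P. *)
have FM a K : F K -> is_local P K -> ~ K a -> F (M a).
  move=> FK lK nKa; apply: up FK => k Kk.
  have [r nPr [[c E]|[c E]]] := prufer_div pr P k a.
    by exists r => //; exists c.
  case: nKa; apply: (lK r) => //.
  by rewrite E mulrC; exact: idealM.
have T0 : T 0 by move=> K _ _; exact: ideal0.
have TD a b : T a -> T b -> T (a + b).
  by move=> Ta Tb K FK lK; apply: idealD; [exact: Ta|exact: Tb].
have TM a b : T b -> T (a * b) by move=> Tb K FK lK; apply: idealM; exact: Tb.
have lP : is_local P (prime_ideal P) by move=> s y; exact: spec_cancel.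
have TP : T `<=` P by move=> y /(_ _ FP lP).
have T1 : ~ T 1 by move=> /TP; exact: spec1.
have Tp a b : T (a * b) -> T a \/ T b.
  move=> Tab; apply: contrapT => /not_orP[].
  move=> /existsNP[A /not_implyP[FA /not_implyP[lA nAa]]].
  move=> /existsNP[B /not_implyP[FB /not_implyP[lB nBb]]].
  have a0 : a != 0 by apply/eqP => a0; apply: nAa; rewrite a0; exact: ideal0.
  have b0 : b != 0 by apply/eqP => b0; apply: nBb; rewrite b0; exact: ideal0.
  pose C := saturation P (principal (a * b)).
  (* F contains P, hence also the contraction of ab P D_P; this ideal misses ab. *)
  pose N := saturation P (ideal_mulP (a * b) P).
  have FC : F C.
    apply: (localizing_mul locF (FM _ _ FA lA nAa) (FM _ _ FB lB nBb)).
    move=> u v [s nPs [c _ E]] [r nPr [d _ E']].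
    exists (s * r); first exact: specNM.
    exists (c * d) => //; transitivity (a * c * (b * d)); first by ring.
    by rewrite E E'; ring.
  have FN : F N.
    apply: (localizing_mul locF FC FP) => u v [s nPs [c _ E]] Pv.
    by exists s => //; exists (c * v); [exact: specM|rewrite !mulrA E].
  have [s nPs [p Pp /esym]] := Tab _ FN (@saturation_local _ _ _).
  by rewrite mulrC => /(mulfI (mulf_neq0 a0 b0)) E; apply: nPs; rewrite E.
pose Q := @spec_of_ideal _ (MkIdeal T0 TD TM) T1 Tp.
have FsubQ K y : F K -> Q y -> exists2 s, ~ Q s & K (s * y).
  move=> FK Qy.
  have [|s nPs Ksy] := Qy (saturation P K) _ (@saturation_local _ _ _).
    by apply: up FK; exact: sub_saturation.
  by exists s => // /TP.
(* If Q is in F, so is its square, and minimality of the cut makes Q idempotent and a bound for F.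
   Then the condition at Q puts Q inside L, so L is in F. *)
have [FQ|nFQ] := pselect (F (prime_ideal Q)).
  have idQ : idempotent_ideal Q.
    apply/locally_squareP => t Qt.
    have FQQ : F (square_ideal Q).
      apply: (localizing_mul locF FQ FQ) => a b Qa Qb.
      by exists 1%N, (fun=> a), (fun=> b); rewrite big_ord1.
    have [s nQs /mul_set_factor[r [a [b [nQr Qa Qb E]]]]] := FsubQ _ _ FQQ Qt.
    by exists (r * s), a, b; split=> //; [exact: specNM|rewrite -mulrA].
  have QIJ : idem_bounded F Q by split=> // K FK y; exact: FsubQ.
  apply: nFL; apply: up FQ => t Qt.
  have [r [a [b [nPr Qa Qb E]]]] :=
    locally_square_at (iffLR (locally_squareP _) idQ) TP Qt.
  have [s nQs /IL Lsa] := IY _ QIJ _ Qa.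
  have [q nPq [[d Ed]|[d Ed]]] := prufer_div pr P b s.
    apply: (lL (q * r)); first exact: specNM.
    suff -> : q * r * t = d * (s * a) by exact: idealM.
    by transitivity (q * (a * b)); [rewrite -E; ring|ring: Ed].
  have nQq : ~ Q q by move=> /TP.
  by exfalso; apply: (specNM nQq nQs); rewrite Ed mulrC; exact: specM.
(* If Q is not in F, I has an element l outside Q, hence outside some local K in F. Then [M l] is in
   F and lies inside L. *)
have [l /IL Ll] := IX _ nFQ.
move=> /existsNP[K /not_implyP[FK /not_implyP[lK nKl]]].
apply: nFL; apply: up (FM _ _ FK lK nKl) => y [s nPs [c _ E]].
by apply: (lL s) => //; rewrite -E mulrC; exact: idealM.
Qed.

End Prufer.
End LocalizingSystems.

(** * Stable semistar operations *)

Section StableSemistar.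
Variable D : idomainType.
Local Notation K := {fraction D}.
Implicit Types (I J : ideal D) (E G : submodule D) (s t : semistar D).

Definition frac_ideal I : submodule D.
Proof.
exists [set d%:F | d in I].
- by exists 0; [exact: ideal0|rewrite tofrac0].
- move=> _ _ [d Id <-] [e Ie <-]; exists (d + e); last exact: tofracD.
  exact: idealD.
- by move=> a _ [d Id <-]; exists (a * d); [exact: idealM|exact: tofracM].
Defined.

Lemma frac_ideal1 I : frac_ideal I 1 <-> I 1.
Proof.
split=> [[d Id /eqP]|I1]; last by exists 1; rewrite ?tofrac1.
by rewrite -tofrac1 tofrac_eq => /eqP <-.
Qed.

Definition conductor E (x : K) : ideal D.
Proof.
exists [set d | E (d%:F * x)].
- by rewrite /= tofrac0 mul0r; exact: submodule0.
- by move=> d e; rewrite /= tofracD mulrDl; exact: submoduleD.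
- by move=> a d; rewrite /= tofracM -mulrA; exact: submoduleZ.
Defined.

Definition unit_system s : set (ideal D) := [set I | s (frac_ideal I) 1].

Lemma unit_system_localizing s : localizing (unit_system s).
Proof.
split.
- by apply: star_ext; apply/frac_ideal1.
- rewrite /unit_system /=.
  have -> : frac_ideal (zero_ideal D) =
      scale_submodule 0 (frac_ideal (zero_ideal D)).
    apply: submodule_eq; apply/seteqP; split=> [_ [_ -> <-]|_ [y _ <-]] /=.
      by exists 0; [by exists 0; rewrite ?tofrac0|rewrite mul0r tofrac0].
    by exists 0; rewrite // mul0r tofrac0.
  by rewrite star_scale => -[y _ /eqP]; rewrite mul0r eq_sym oner_eq0.
- by move=> I J IJ; apply: star_mono => _ [d Id <-]; exists d => //; exact: IJ.
- move=> I J; rewrite /unit_system /= => FI h.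
  (* Each d in I lies in the closure of J, being d times an element of the closure of (J : d). *)
  rewrite -[s (frac_ideal J)]star_idem; move: 1 FI; apply: star_mono.
  move=> _ [d Id <-].
  have : scale_submodule d%:F (s (frac_ideal (colon J d))) d%:F.
    by exists 1; [exact: h|rewrite mulr1].
  rewrite -star_scale; apply: star_mono => _ [_ [e Je <-] <-].
  by exists (e * d); rewrite // mulrC tofracM.
Qed.

(** For x nonzero the conductor is the intersection of x^-1 E with D, and stability lets the closure
    pass through this intersection. Hence s is determined by its system. *)
Lemma unit_system_conductor s E x : stable s ->
  s E x <-> unit_system s (conductor E x).
Proof.
move=> /asboolP st; have [->|x0] := eqVneq x 0.
  split=> _; last exact: submodule0.
  apply: star_ext; apply/frac_ideal1; rewrite /= mulr0; exact: submodule0.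
have U1 : s (frac_ideal (unit_ideal D)) 1 by apply: star_ext; apply/frac_ideal1.
rewrite /unit_system /=.
have -> : frac_ideal (conductor E x) =
    submoduleI (scale_submodule x^-1 E) (frac_ideal (unit_ideal D)).
  apply/submodule_eq/seteqP.
  split=> [_ [d Ed <-]|_ [[y Ey <-] [d _ dE]]].
    by split; [exists (d%:F * x) => //; rewrite mulrCA mulVf ?mulr1|exists d].
  by exists d => //; rewrite /= dE mulrAC mulVf ?mul1r.
rewrite st star_scale; split=> [Ex|[[y Ey /(canRL (mulVKf x0))]]].
  by split=> //; exists x => //; rewrite mulVf.
by rewrite mulr1 => <-.
Qed.

Section FromLocalizing.
Variables (F : set (ideal D)) (locF : localizing F).

(** The union of the (E : I) over I in F, taken in the fraction field. *)
Definition localized E : submodule D.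
Proof.
exists [set x | F (conductor E x)]; have [F1 _ up _] := locF.
- by apply: up F1 => d _; rewrite /= mulr0; exact: submodule0.
- move=> x y Fx Fy; apply: up (localizingI locF Fx Fy) => d [Ex Ey].
  by rewrite /= mulrDr; exact: submoduleD.
- by move=> a x; apply: up => d; rewrite /= mulrCA; exact: submoduleZ.
Defined.

Lemma localized_ext E : E `<=` localized E.
Proof.
have [F1 _ up _] := locF.
by move=> x Ex; apply: up F1 => d _; exact: submoduleZ.
Qed.

Lemma localized_mono E G : E `<=` G -> localized E `<=` localized G.
Proof. by have [_ _ up _] := locF; move=> EG x; apply: up => d; exact: EG. Qed.

Lemma localized_idem E : localized (localized E) = localized E.
Proof.
apply/submodule_eq/seteqP; split; last exact: localized_ext.
have [_ _ up comp] := locF; move=> x Fx; apply: (comp _ _ Fx) => d.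
by apply: up => e; rewrite /= tofracM mulrA.
Qed.

Lemma localized_scale x E :
  localized (scale_submodule x E) = scale_submodule x (localized E).
Proof.
have [_ F0 up _] := locF.
apply/submodule_eq/seteqP; split; have [->|x0] := eqVneq x 0.
- move=> y Fy; exists 0; first exact: submodule0.
  (* The conductor of 0 at a nonzero y is the zero ideal, which is not in F. *)
  rewrite mul0r; apply/esym/eqP; apply: contra_notT F0 => y0.
  apply: up Fy => d [e _ /esym/eqP].
  by rewrite mul0r mulf_eq0 (negPf y0) orbF tofrac_eq0 => /eqP.
- move=> y Fy; exists (x^-1 * y); last by rewrite mulVKf.
  by apply: up Fy => d [e Ee /= E']; rewrite /= mulrCA -E' mulKf.
- by move=> _ [y _ <-]; rewrite mul0r; exact: submodule0.
- move=> _ [y Fy <-]; apply: up Fy => d Ed.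
  by exists (d%:F * y); rewrite // mulrCA.
Qed.

Definition localizing_semistar : semistar D :=
  MkSemistar localized_ext localized_mono localized_idem localized_scale.

Lemma localizing_semistar_stable : stable localizing_semistar.
Proof.
have [_ _ up _] := locF.
apply/asboolP => E G; apply/submodule_eq/seteqP; split=> [x Fx|x [FE FG]].
  by split; apply: up Fx => d [].
by apply: up (localizingI locF FE FG) => d.
Qed.

Lemma unit_system_localizing_semistar : unit_system localizing_semistar = F.
Proof.
have [_ _ up _] := locF.
apply/seteqP; split=> I; apply: up => d; rewrite /= mulr1.
  by move=> [e Ie /eqP]; rewrite tofrac_eq => /eqP <-.
by exists d.
Qed.

End FromLocalizing.

Implicit Types p q : SStar_st D.

Lemma le_unit_system p q :
  (p <= q)%O <-> unit_system (val p) `<=` unit_system (val q).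
Proof.
have -> : (p <= q)%O = semistar_le (val p) (val q) by [].
split=> [/asboolP pq I|pq]; first exact: pq.
apply/asboolP => E x /(unit_system_conductor _ _ (valP p))/pq.
by move=> /(unit_system_conductor E x (valP q)).
Qed.

Section Prufer.
Hypotheses (pr : prufer_domain D) (cnt : countable [set: Spec D]).

Lemma unit_system_cut p : unit_system (val p) =
  cut_system (excluded (unit_system (val p)))
    (idem_bounded (unit_system (val p))).
Proof.
have locF := unit_system_localizing (val p).
by apply/seteqP; split=> I /(localizing_cut_system pr cnt locF).
Qed.

Lemma le_cuts p q : (p <= q)%O <->
  excluded (unit_system (val q)) `<=` excluded (unit_system (val p)) /\
  idem_bounded (unit_system (val q)) `<=` idem_bounded (unit_system (val p)).
Proof.
rewrite le_unit_system; split=> [pq|[X Y]].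
  split=> T; first by apply: contra_not; exact: pq.
  by move=> [idT qT]; split=> //; exact: subset_trans pq qT.
rewrite (unit_system_cut p) (unit_system_cut q) => I [IX IY].
by split=> T; [move=> /X/IX|move=> /Y/IY].
Qed.

End Prufer.
End StableSemistar.

(** * Transport of stable operations along an isomorphism of spectra *)

Definition same_cuts D1 D2 (psi : Spec D1 -> Spec D2)
    (p : SStar_st D1) (q : SStar_st D2) := forall P,
  (excluded (unit_system (val p)) P <->
   excluded (unit_system (val q)) (psi P)) /\
  (idem_bounded (unit_system (val p)) P <->
   idem_bounded (unit_system (val q)) (psi P)).

Section Transport.
Variables (D1 D2 : idomainType) (psi : Spec D1 -> Spec D2).
Variable psi' : Spec D2 -> Spec D1.
Hypotheses (pr1 : prufer_domain D1) (pr2 : prufer_domain D2).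
Hypotheses (cnt1 : countable [set: Spec D1]) (cnt2 : countable [set: Spec D2]).
Hypotheses (psiK : cancel psi psi') (psiK' : cancel psi' psi).
Hypothesis psi_sub : forall P Q, psi P `<=` psi Q <-> P `<=` Q.
Hypothesis psi_idem :
  forall P : Spec D1, idempotent_ideal P <-> idempotent_ideal (psi P).

Lemma same_cuts_le p1 q1 p2 q2 : same_cuts psi p1 p2 -> same_cuts psi q1 q2 ->
  (p1 <= q1)%O <-> (p2 <= q2)%O.
Proof.
move=> p12 q12; rewrite (le_cuts pr1 cnt1) (le_cuts pr2 cnt2).
split=> -[X Y]; split=> P.
- by rewrite -(psiK' P) => /(q12 _).1/X/(p12 _).1.
- by rewrite -(psiK' P) => /(q12 _).2/Y/(p12 _).2.
- by move=> /(q12 _).1/X/(p12 _).1.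
- by move=> /(q12 _).2/Y/(p12 _).2.
Qed.

(** q comes from the cut system of the transported sets X2, Y2. The cuts of both operations are
    computed from (X, Y) and (X2, Y2) by the same formulas in inclusions and idempotence, which
    [psi] respects. *)
Lemma exists_same_cuts p : exists q, same_cuts psi p q.
Proof.
have locF := unit_system_localizing (val p).
pose X := excluded (unit_system (val p)).
pose Y := idem_bounded (unit_system (val p)).
pose X2 := [set Q | X (psi' Q)]; pose Y2 := [set Q | Y (psi' Q)].
have X20 : X2 (zero_spec D2).
  have psi0 : psi (zero_spec D1) `<=` zero_spec D2.
    by rewrite -(psiK' (zero_spec D2)); apply/psi_sub => _ ->; exact: spec0.
  have [_ F0 up _] := locF => F0'; apply: F0; apply: up F0' => x.
  have : psi' (zero_spec D2) `<=` zero_spec D1; last by apply.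
  by apply/psi_sub; rewrite psiK' => _ ->; exact: spec0.
have Y2id : Y2 `<=` @idempotent_ideal D2.
  by move=> Q [/psi_idem]; rewrite psiK'.
have Yid : Y `<=` @idempotent_ideal D1 by move=> Q [].
have loc2 := cut_system_localizing pr2 X20 Y2id.
exists (Sub (localizing_semistar loc2) (localizing_semistar_stable loc2)) => P.
rewrite SubK unit_system_localizing_semistar.
rewrite (unit_system_cut pr1 cnt1 p) -/X -/Y.
split.
  rewrite !excluded_cut_system; split=> -[Q PQ XYQ].
    exists (psi Q); first exact/psi_sub.
    rewrite /X2 /Y2 /= psiK; case: XYQ => [|[YQ PneQ]]; [by left|right].
    by split=> // /(can_inj psiK).
  exists (psi' Q); first by apply/psi_sub; rewrite psiK'.
  case: XYQ => [|[YQ PneQ]]; [by left|right].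
  by split=> // PQ'; apply: PneQ; rewrite PQ' psiK'.
rewrite (idem_bounded_cut_system pr1 _ _ Yid).
rewrite (idem_bounded_cut_system pr2 _ _ Y2id).
split=> -[/psi_idem idP h]; split=> // U UP UneP.
  have [||S [SP nSU [Q SQ XYQ]]] := h (psi' U).
  - by apply/psi_sub; rewrite psiK'.
  - by move=> UP'; apply: UneP; rewrite -UP' psiK'.
  - exists (psi S); split; first exact/psi_sub.
      by rewrite -(psiK' U) => /psi_sub.
    by exists (psi Q); [exact/psi_sub|rewrite /X2 /Y2 /= psiK].
have [||S [SP nSU [Q SQ XYQ]]] := h (psi U).
- exact/psi_sub.
- by move=> /(can_inj psiK).
- exists (psi' S); split; first by apply/psi_sub; rewrite psiK'.
    by move=> /psi_sub; rewrite psiK'.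
  by exists (psi' Q) => //; apply/psi_sub; rewrite !psiK'.
Qed.

End Transport.

(** Every Zariski open set containing Q contains each prime P inside Q; this is applied to the
    preimage of the open set of primes missing a. *)
Lemma continuous_spec_sub D1 D2 (f : Spec D1 -> Spec D2) : continuous f ->
  forall P Q : Spec D1, P `<=` Q -> f P `<=` f Q.
Proof.
move=> /continuousP cf P Q PQ a fPa; apply: contrapT => nfQa.
have /cf[A AE] : open (~` zariski_closed [set a] : set (Spec D2)).
  by exists [set a].
have : (f @^-1` (~` zariski_closed [set a])) Q by move=> /(_ a erefl).
rewrite AE => nAQ; have : (~` zariski_closed A) P.
  by move=> AP; apply: nAQ => x /AP /PQ.
by rewrite -AE; apply => _ ->.
Qed.

Theorem corollary6p10 (D1 D2 : idomainType)
    (prufer1 : prufer_domain D1) (prufer2 : prufer_domain D2)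
    (countable1 : countable [set: Spec D1])
    (countable2 : countable [set: Spec D2])
    (phi : Spec D1 -> Spec D2) (homeo_phi : homeomorphism phi)
    (idem_phi : forall P : Spec D1,
        idempotent_ideal P <-> idempotent_ideal (phi P)) :
  exists Phi : SStar_st D1 -> SStar_st D2,
    bijective Phi /\
    {mono Phi : s t / (s <= t)%O}.
Proof.
have [cphi [phi' [phiK phiK' cphi']]] := homeo_phi.
have phi_sub (P Q : Spec D1) : phi P `<=` phi Q <-> P `<=` Q.
  split; last exact: continuous_spec_sub.
  by move=> /(continuous_spec_sub cphi'); rewrite !phiK.
have phi'_sub (P Q : Spec D2) : phi' P `<=` phi' Q <-> P `<=` Q.
  by rewrite -phi_sub !phiK'.
have phi'_idem (P : Spec D2) : idempotent_ideal P <-> idempotent_ideal (phi' P).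
  by rewrite idem_phi phiK'.
have /choice[Phi PhiP] := exists_same_cuts prufer1 prufer2 countable1 phiK phiK'
  phi_sub idem_phi.
have /choice[Psi PsiP] := exists_same_cuts prufer2 prufer1 countable2 phiK' phiK
  phi'_sub phi'_idem.
have {}PsiP q : same_cuts phi (Psi q) q.
  move=> P; have := PsiP q (phi P); rewrite phiK => -[? ?].
  by split; apply: iff_sym.
have le p1 q1 p2 q2 := same_cuts_le prufer1 prufer2 countable1 countable2 phiK'
  (p1 := p1) (q1 := q1) (p2 := p2) (q2 := q2).
have mono : {mono Phi : s t / (s <= t)%O}.
  by move=> s t; apply/idP/idP => /(le _ _ _ _ (PhiP s) (PhiP t)).
(* [Psi (Phi p)] and [p] both have the same cuts as [Phi p], so each is below the other; likewise
   for the other composite. *)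
exists Phi; split=> //; exists Psi => p; apply/le_anti/andP; split.
- by apply/(le _ _ _ _ (PsiP _) (PhiP _)); exact: lexx.
- by apply/(le _ _ _ _ (PhiP _) (PsiP _)); exact: lexx.
- by apply/(le _ _ _ _ (PhiP _) (PsiP _)); exact: lexx.
- by apply/(le _ _ _ _ (PsiP _) (PhiP _)); exact: lexx.
Qed.
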